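(* Let $X$ be a set, and let $S$ be a distinguished class of recursive elements with inclusion map $i:S\to X$. Let $\alpha$ carry a well-founded strict order $<$, let $\mu:X\to\alpha$ be a map (the measure), and write $z\prec_\mu x$ when $\mu(z)<\mu(x)$, for $x,z\in X$. Let $P:X\to\mathrm{Prop}$ and $P_S:S\to\mathrm{Prop}$ be properties satisfying $P_S(s)\leftrightarrow P(i(s))$ for all $s\in S$. Let $B\subseteq X$ (the base or nonrecursive predicate) and $R_S\subseteq S$ (the sliceability predicate) be predicates, let $\sigma:\{s\in S\mid R_S(s)\}\to X$ be a map (the slice map), and let $\sim_S$ be a binary relation on $S$ (the local transport relation). Assume that (1) $P(x)$ holds whenever $x\in X$ satisfies $x\notin\mathrm{im}(i)$ or $x\in B$; (2) if $s\in S$ and $i(s)\notin B$, then there are $t\in S$ and a proof $h_t:R_S(t)$ such that $t\sim_S s$ and $\sigma(t,h_t)\prec_\mu i(s)$; (3) for every $t\in S$ and every $h_t:R_S(t)$, $P(\sigma(t,h_t))$ implies $P_S(t)$; (4) for all $s,t\in S$, $t\sim_S s$ and $P_S(t)$ imply $P_S(s)$. Then $P(x)$ holds for every $x\in X$.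
   Context: $\sigma(t,h_t)$ denotes the value of $\sigma$ at $t\in S$ together with a proof $h_t$ that $R_S(t)$ holds; the slice lies in $X$, not necessarily in the image of $S$. In type-theoretic form, $S$ is a type and the inclusion $i$ is represented by a function $S\to X$; no further property of this function is assumed. The relation $\sim_S$ is not assumed to be an equivalence relation. Well-foundedness of $<$ on $\alpha$ means that well-founded induction along $<$ is valid. *)

(* Defs.v *)
(* Stdlib world. *)
From Stdlib Require Export RelationClasses.

Definition measure_lt {X A : Type} (ltA : A -> A -> Prop) (mu : X -> A)
    (z x : X) : Prop :=
  ltA (mu z) (mu x).

(* The inclusion [i] need not be injective, so membership in the image is a
   bare existence statement. *)
Definition in_image {S X : Type} (i : S -> X) (x : X) : Prop :=
  exists s : S, i s = x.

(* Main.v *)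
Require Import Defs.
From Stdlib Require Import Classical Wellfounded.

(** Well-founded induction on the measure. At a recursive [i s] outside [B], the descent goes
    through a companion [t] of [s]: only the slice of [t] has to be smaller than [i s], and [P] then
    travels from that slice to [t] and across [simS] to [s]. *)

Theorem theorem2 (X S : Type) (i : S -> X)
    (A : Type) (ltA : A -> A -> Prop)
    (ltA_strict : StrictOrder ltA) (ltA_wf : well_founded ltA)
    (mu : X -> A)
    (P : X -> Prop) (PS : S -> Prop)
    (P_compat : forall s : S, PS s <-> P (i s))
    (B : X -> Prop) (RS : S -> Prop)
    (sigma : {s : S | RS s} -> X)
    (simS : S -> S -> Prop)
    (H1 : forall x : X, ~ in_image i x \/ B x -> P x)
    (H2 : forall s : S, ~ B (i s) ->
      exists (t : S) (ht : RS t),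
        simS t s /\ measure_lt ltA mu (sigma (exist RS t ht)) (i s))
    (H3 : forall (t : S) (ht : RS t), P (sigma (exist RS t ht)) -> PS t)
    (H4 : forall s t : S, simS t s -> PS t -> PS s) :
  forall x : X, P x.
Proof.
  apply (well_founded_ind (wf_inverse_image X A ltA mu ltA_wf)).
  intros x IH.
  (* Neither the image nor [B] is assumed decidable, hence excluded middle; any preimage [s] of [x]
     will do. *)
  destruct (classic (in_image i x)) as [[s <-] | Hx]; [| now apply H1; left].
  destruct (classic (B (i s))) as [HB | HB]; [now apply H1; right |].
  destruct (H2 s HB) as (t & ht & Hts & Hlt).
  (* Backwards from [P (i s)]: [PS s], [PS t], [P] at the slice, where [Hlt] licenses [IH]. *)
  apply P_compat, (H4 s t Hts), (H3 t ht), IH, Hlt.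
Qed.
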